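(* Let $(N,\mu_0)$ be a perpetual free-choice system. Then $(N,\mu_0)$ is lucent: for any two markings $\mu_1,\mu_2$ reachable in $(N,\mu_0)$, $$en(N,\mu_1)=en(N,\mu_2)\implies \mu_1=\mu_2.$$
   Context: A net $N=(P,T,F)$ is a finite directed bipartite graph: $P$ (places) and $T$ (transitions) are disjoint finite sets and $F\subset (P\times T)\cup(T\times P)$. Nets are assumed weakly connected. For a node $x$, ${}^\bullet x=\{y:(y,x)\in F\}$ and $x^\bullet=\{y:(x,y)\in F\}$. $N$ is a free-choice net if for every $(p,t)\in F\cap(P\times T)$ one has ${}^\bullet t\times p^\bullet\subset F$. The cluster of a node $x$ is the smallest subnet containing $x$ which, with each of its places $p$, contains $p^\bullet$ and, with each of its transitions $t$, contains ${}^\bullet t$. A marking is a map $\mu:P\to\mathbb{N}$; a transition $t$ is enabled at $\mu$ if $\mu(p)\ge 1$ for all $p\in{}^\bullet t$; firing $t$ removes one token from each place of ${}^\bullet t$ and adds one token to each place of $t^\bullet$. $en(N,\mu)$ denotes the set of transitions enabled at $\mu$. A marking is reachable in $(N,\mu_0)$ if it arises from $\mu_0$ by firing a finite sequence of successively enabled transitions. A home marking is a marking reachable from every reachable marking. $(N,\mu_0)$ is live if from every reachable marking, for every transition $t$, some marking enabling $t$ is reachable; it is bounded if there is $K$ with $\mu(p)\le K$ for all reachable $\mu$ and all places $p$. A free-choice system is a pair $(N,\mu_0)$ with $N$ a free-choice net. For a cluster $cl$, $\mu_{cl}$ is the marking with $\mu_{cl}(p)=1$ if $p$ is a place of $cl$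 and $0$ otherwise. $(N,\mu_0)$ is perpetual if it is live and bounded and there is a cluster $cl$ such that $\mu_{cl}$ is a home marking of $(N,\mu_0)$. *)

(* Defs.v *)
(* Petri nets with places P and transitions T (finTypes,
   disjoint by construction). The flow relation F is split into
   pt : P -> T -> bool  ((p,t) \in F)  and  tp : T -> P -> bool  ((t,p) \in F). *)
From mathcomp Require Import all_boot.
Set Implicit Arguments. Unset Strict Implicit. Unset Printing Implicit Defensive.

Section Nets.
Variables (P T : finType) (pt : P -> T -> bool) (tp : T -> P -> bool).

Definition node_adj : rel (P + T) := fun x y =>
  match x, y with
  | inl p, inr t => pt p t || tp t p
  | inr t, inl p => pt p t || tp t p
  | _, _ => false
  end.

Definition weakly_connected : Prop :=
  forall x y : P + T, connect node_adj x y.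

Definition free_choice : Prop :=
  forall p t, pt p t -> forall p' t', pt p' t -> pt p t' -> pt p' t'.

Definition cluster_step : rel (P + T) := fun x y =>
  match x, y with
  | inl p, inr t => pt p t
  | inr t, inl p => pt p t
  | _, _ => false
  end.

Definition cluster (x : P + T) : {set P + T} := [set y | connect cluster_step x y].

Definition marking := {ffun P -> nat}.

Definition enabled (m : marking) (t : T) : bool :=
  [forall p, pt p t ==> (0 < m p)].

Definition en (m : marking) : {set T} := [set t | enabled m t].

Definition fire (m : marking) (t : T) : marking :=
  [ffun p => m p - pt p t + tp t p].

Inductive reachable (m : marking) : marking -> Prop :=
  | reach_refl : reachable m m
  | reach_step m1 t : reachable m m1 -> enabled m1 t -> reachable m (fire m1 t).

Definition live (m0 : marking) : Prop :=
  forall m, reachable m0 m -> forall t, exists2 m', reachable m m' & enabled m' t.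

Definition bounded (m0 : marking) : Prop :=
  exists K, forall m, reachable m0 m -> forall p, m p <= K.

Definition home_marking (m0 h : marking) : Prop :=
  forall m, reachable m0 m -> reachable m h.

Definition cluster_marking (x : P + T) : marking :=
  [ffun p => if inl p \in cluster x then 1 else 0].

Definition perpetual (m0 : marking) : Prop :=
  [/\ live m0, bounded m0 & exists x : P + T, home_marking m0 (cluster_marking x)].

Definition lucent (m0 : marking) : Prop :=
  forall m1 m2, reachable m0 m1 -> reachable m0 m2 -> en m1 = en m2 -> m1 = m2.

End Nets.

(* Main.v *)
(* Let [h] be the marking of the home cluster, the preset of a transition [t0].

   Boundedness and a tour of all transitions from [h] back to [h] make the net strongly
   connected, and a free-choice exchange argument shows that no reachable marking lies
   strictly above [h]. Choosing one transition per cluster that leads towards the home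
   cluster therefore drives every reachable marking exactly to [h]. If the choices follow
   a path that ends in the home cluster and meets every cluster at most once (a rooted
   path), tokens on the path stay on it until they reach the home cluster, where only one
   fits: a rooted path never carries more than one token.

   Suppose [m1] and [m2] enable the same transitions, [p] is marked at [m1] and not at
   [m2], and take a rooted path from [p]. Some place [q] of the cluster of [p] is unmarked
   at [m1]. Tracing back the token that will eventually reach [q] extends the path (with
   [q] in place of [p]) to a rooted path starting in a cluster enabled at [m1], hence at
   [m2]. Pushing that token along it from [m2] enables the cluster of [p]; tracing back the
   token that reached [p] gives a rooted path through [p] starting in a cluster enabled at
   [m2], hence at [m1]. At [m1] this path carries two tokens. *)
Require Import Defs.
From mathcomp Require Import all_boot.
From mathcomp Require Import zify.

Set Implicit Arguments. Unset Strict Implicit. Unset Printing Implicit Defensive.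

Lemma has_splitP (X : Type) (a : pred X) (s : seq X) : has a s ->
  exists s1 x s2, [/\ s = s1 ++ x :: s2, a x & ~~ has a s1].
Proof. by case/split_find => x s1 s2 ax no; exists s1, x, s2; rewrite cat_rcons. Qed.

(** * Firing sequences of a net *)

Section Runs.
Variables (P T : finType) (pt : P -> T -> bool) (tp : T -> P -> bool).
Implicit Types (m a b : marking P) (s : seq T) (t u : T) (p q : P).

Local Notation enabled := (enabled pt).
Local Notation fire := (fire pt tp).
Local Notation reachable := (reachable pt tp).

Fixpoint fireable m s : bool :=
  if s is t :: s' then enabled m t && fireable (fire m t) s' else true.

Lemma enabledP m t : reflect (forall p, pt p t -> 0 < m p) (enabled m t).
Proof. by apply: (iffP forallP) => H p; [move/implyP: (H p) | apply/implyP/H]. Qed.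

Lemma enabled_le m a t : (forall p, pt p t -> m p <= a p) -> enabled m t -> enabled a t.
Proof. by move=> le_ma /enabledP en; apply/enabledP => p ptp; apply: leq_trans (le_ma p ptp); exact: en. Qed.

Lemma fireE m t p : fire m t p = m p - pt p t + tp t p.
Proof. by rewrite ffunE. Qed.

Lemma fire_addE m t p : enabled m t -> fire m t p + pt p t = m p + tp t p.
Proof.
move=> /enabledP /(_ p); rewrite fireE.
by case: (pt p t) => /= [/(_ isT)|_]; lia.
Qed.

Lemma fireable_cat m s s' :
  fireable m (s ++ s') = fireable m s && fireable (foldl fire m s) s'.
Proof. by elim: s m => //= t s IH m; rewrite IH andbA. Qed.

Lemma reachableP m m' :
  reachable m m' <-> exists2 s, fireable m s & foldl fire m s = m'.
Proof.
split=> [|[s fs <-]].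
  elim=> [|m1 t _ [s fs e] en]; first by exists [::].
  exists (rcons s t); last by rewrite foldl_rcons e.
  by rewrite -cats1 fireable_cat fs e /= en.
elim/last_ind: s fs => [|s t IH]; first by move=> _; apply: reach_refl.
rewrite -cats1 fireable_cat foldl_cat /= andbT => /andP[fs en].
by apply: reach_step => //; apply: IH.
Qed.

Lemma reachable_run m s : fireable m s -> reachable m (foldl fire m s).
Proof. by move=> fs; apply/reachableP; exists s. Qed.

Lemma reachable_trans m1 m2 m3 : reachable m1 m2 -> reachable m2 m3 -> reachable m1 m3.
Proof. by move=> r12; elim=> // m t _ r en; apply: reach_step. Qed.

Lemma state_equation m s p : fireable m s ->
  foldl fire m s p + \sum_(u <- s) pt p u = m p + \sum_(u <- s) tp u p.
Proof.
elim: s m => [|t s IH] m /=; first by rewrite !big_nil.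
case/andP=> en fs; rewrite !big_cons; have := IH _ fs; have := fire_addE p en.
by lia.
Qed.

Lemma unconsumed_le m s p : fireable m s -> ~~ has (pt p) s -> m p <= foldl fire m s p.
Proof.
move=> fs /hasPn nos; have := state_equation p fs.
rewrite [X in _ + X = _]big_seq big1 => [|u us]; first by lia.
by rewrite (negbTE (nos u us)).
Qed.

Lemma fireable_le m a s : (forall p, m p <= a p) -> fireable m s -> fireable a s.
Proof.
elim: s m a => //= t s IH m a le_ma /andP[en fs]; rewrite (@enabled_le m a) //=.
by apply: IH fs => p; rewrite !fireE; have := le_ma p; lia.
Qed.

(** Nothing in [s1] takes tokens from the preset of [t], so [t] stays enabled and commutes with each
    of these firings. *)
Lemma fireable_exchange m s1 t s2 :
  fireable m (s1 ++ t :: s2) -> enabled m t ->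
  (forall u p, u \in s1 -> pt p u -> ~~ pt p t) ->
  fireable m (t :: s1 ++ s2) /\
  foldl fire m (t :: s1 ++ s2) = foldl fire m (s1 ++ t :: s2).
Proof.
elim: s1 m => [|u s1 IH] m //= /andP[enu fs] ent dis.
have disu p : pt p u -> ~~ pt p t by apply: dis; rewrite mem_head.
have ent' : enabled (fire m u) t.
  apply: enabled_le ent => p ptt; rewrite fireE.
  have /negbTE -> : ~~ pt p u by apply: contraL ptt; apply: disu.
  by lia.
have enu' : enabled (fire m t) u.
  by apply: enabled_le enu => p /disu /negbTE ptt; rewrite fireE ptt; lia.
have swap : fire (fire m t) u = fire (fire m u) t.
  apply/ffunP => p.
  have := fire_addE p ent; have := fire_addE p enu.
  by have := fire_addE p ent'; have := fire_addE p enu'; lia.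
have [|/andP[_ fs'] e'] := IH _ fs ent'.
  by move=> v p vs1; apply: dis; rewrite inE vs1 orbT.
by rewrite ent enu' swap.
Qed.

(* Transitions of [U] only feed the places of [S] and all consumers of [S] lie in
   [U], so dropping [U] from a run can only leave more tokens everywhere. *)
Lemma fireable_filter (S : pred P) (U : pred T) m a s :
  (forall p t, S p -> pt p t -> U t) -> (forall p t, U t -> tp t p -> S p) ->
  (forall p, ~~ S p -> m p <= a p) -> fireable m s ->
  fireable a (filter (predC U) s) /\
  forall p, ~~ S p -> foldl fire m s p <= foldl fire a (filter (predC U) s) p.
Proof.
move=> SU US; elim: s m a => //= t s IH m a le_ma /andP[en fs].
have [Ut|nUt] /= := boolP (U t).
  apply: IH fs => p nSp; rewrite fireE.
  have -> : tp t p = false by apply: contraNF nSp; apply: US.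
  by have := le_ma p nSp; lia.
rewrite (@enabled_le m a) //=; last first.
  by move=> p ptt; apply: le_ma; apply: contra nUt => Sp; apply: SU Sp ptt.
by apply: IH fs => p nSp; rewrite !fireE; have := le_ma p nSp; lia.
Qed.

(** While [p] is empty no consumer of [p] can fire; [t] is the first producer of [p] in [s]. *)
Lemma first_mark m s p : fireable m s -> m p = 0 -> 0 < foldl fire m s p ->
  exists s1 t s2, [/\ s = s1 ++ t :: s2, foldl fire m s1 p = 0,
    ~~ has (pt p) s1, ~~ pt p t & tp t p].
Proof.
elim: s m => [|t s IH] m /=; first by move=> _ ->.
case/andP=> en fs mp0 pos.
have npt : ~~ pt p t.
  by apply: contraTN isT => ptt; have /enabledP/(_ p ptt) := en; rewrite mp0.
case tpp: (tp t p); first by exists [::], t, s; split.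
have [||s1 [u [s2 [-> e0 nos np tpu]]]] := IH _ fs; [by rewrite fireE mp0 tpp | by [] |].
by exists (t :: s1), u, s2; split => //=; rewrite negb_or npt.
Qed.

(* Pumping: repeating the run from [m] to [a] would add [a - m] each time. *)
Lemma bounded_no_growth m0 m a : bounded pt tp m0 -> reachable m0 m ->
  reachable m a -> (forall p, m p <= a p) -> a = m.
Proof.
move=> [K bK] r0m /reachableP[s fs ea] le_ma.
have pump k : exists2 b, reachable m0 b & forall p, b p = m p + k * (a p - m p).
  elim: k => [|k [b r0b eb]]; first by exists m => // p; lia.
  have fb : fireable b s by apply: fireable_le fs => p; rewrite eb; lia.
  exists (foldl fire b s); first exact: reachable_trans r0b (reachable_run fb).
  move=> p; have := state_equation p fs; have := state_equation p fb.
  by rewrite ea eb; have := le_ma p; lia.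
apply/ffunP => p; have [b r0b /(_ p) eb] := pump K.+1.
by have := bK _ r0b p; have := le_ma p; nia.
Qed.

End Runs.

(** * Strong connectedness, as the absence of one-way cuts *)

Section HomeMarking.
Variables (P T : finType) (pt : P -> T -> bool) (tp : T -> P -> bool).
Variables (m0 h : marking P).
Hypothesis connN : weakly_connected pt tp.
Hypothesis live0 : live pt tp m0.
Hypothesis bounded0 : bounded pt tp m0.
Hypothesis home_h : home_marking pt tp m0 h.
Implicit Types (m a b : marking P) (s : seq T) (t u : T) (p q : P).

Local Notation enabled := (enabled pt).
Local Notation fire := (fire pt tp).
Local Notation reachable := (reachable pt tp).
Local Notation fireable := (fireable pt tp).

Lemma reachable_home : reachable m0 h.
Proof. exact/home_h/reach_refl. Qed.

Lemma home_tour : exists s, [/\ fireable h s, foldl fire h s = h & forall t, t \in s].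
Proof.
have tour (L : seq T) : exists s, [/\ fireable h s, foldl fire h s = h & {subset L <= s}].
  elim: L => [|t L [s [fs es sub]]]; first by exists [::].
  have [m rm ent] := live0 reachable_home t.
  have /home_h rh : reachable m0 (fire m t).
    by apply: reachable_trans reachable_home _; apply: reach_step.
  have [s1 f1 e1] := (reachableP _ _ _ _).1 rm.
  have [s2 f2 e2] := (reachableP _ _ _ _).1 rh.
  exists (s1 ++ t :: s2 ++ s); split.
  - by rewrite fireable_cat f1 e1 /= ent fireable_cat f2 e2.
  - by rewrite foldl_cat e1 /= foldl_cat e2.
  move=> u; rewrite inE => /orP[/eqP->|/sub us]; first by rewrite mem_cat mem_head orbT.
  by rewrite mem_cat inE mem_cat us !orbT.
by have [s [fs es sub]] := tour (enum T); exists s; split=> // t; apply: sub; rewrite mem_enum.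
Qed.

(* A one-way cut of the net is no cut at all: running the tour of [home_tour]
   without the transitions behind the cut returns to a marking above [h], hence
   to [h], and the state equations of the two runs force the flow across to vanish. *)
Lemma no_oneway_cut (S : pred P) (U : pred T) :
  (forall p t, S p -> pt p t -> U t) -> (forall p t, U t -> tp t p -> S p) ->
  (forall p t, U t -> pt p t -> S p) /\ (forall p t, S p -> tp t p -> U t).
Proof.
move=> SU US; have [s [fs es sT]] := home_tour.
have [fs' le_s'] := fireable_filter SU US (fun p _ => leqnn (h p)) fs.
set s' := filter _ s in fs' le_s'.
have nS p : S p -> \sum_(u <- s') (pt p u : nat) = 0.
  move=> Sp; rewrite big_seq big1 // => u; rewrite mem_filter => /andP[nUu _].
  by case ptu: (pt p u) => //; rewrite /= (SU _ _ Sp ptu) in nUu.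
have e' : foldl fire h s' = h.
  apply: (bounded_no_growth bounded0 reachable_home (reachable_run fs')) => p.
  have [Sp|nSp] := boolP (S p); last by rewrite -{1}es; apply: le_s'.
  by have := state_equation p fs'; rewrite (nS p Sp); lia.
have sum0 (F : T -> bool) u r : \sum_(v <- r) (F v : nat) = 0 -> u \in r -> F u = false.
  move/eqP; rewrite sum_nat_seq_eq0 => /allP F0 /F0 /=; case: (F u) => //.
have split_sum (F : T -> bool) : \sum_(u <- s) (F u : nat) =
    \sum_(u <- filter U s) (F u : nat) + \sum_(u <- s') (F u : nat).
  by rewrite /s' !big_filter (bigID U).
split=> p t.
  move=> Ut ptt; apply: contraTT isT => nSp.
  have nU : \sum_(u <- filter U s) (tp u p : nat) = 0.
    rewrite big_seq big1 // => u; rewrite mem_filter => /andP[Uu _].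
    by case tpu: (tp u p) => //; rewrite (US _ _ Uu tpu) in nSp.
  have U0 : \sum_(u <- filter U s) (pt p u : nat) = 0.
    have := state_equation p fs; have := state_equation p fs'.
    by rewrite e' es !split_sum nU; lia.
  by rewrite (sum0 _ t _ U0) // ?mem_filter ?Ut ?sT in ptt.
move=> Sp tpp; apply: contraTT isT => nUt.
have tp0 : \sum_(u <- s') (tp u p : nat) = 0.
  by have := state_equation p fs'; rewrite e' (nS p Sp); lia.
by rewrite (sum0 (tp^~ p) t _ tp0) // ?mem_filter /= ?nUt ?sT in tpp.
Qed.

(** Arcs across the cut vanish in both directions, so weak connectedness leaves every node on one
    side. *)
Lemma cut_disconnects (S : pred P) (U : pred T) (x y : P + T) :
  (forall p t, S p -> pt p t -> U t) -> (forall p t, U t -> tp t p -> S p) ->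
  let side z := match z with inl p => S p | inr t => U t end in side x -> side y.
Proof.
move=> SU US side; have [US' SU'] := no_oneway_cut SU US.
have /connectP[w xw ->] := connN x y; elim: w x xw => //= z w IH x /andP[adj zw] sx.
apply: IH zw _; case: x z adj sx => [p|t] [q|u] //= /orP[]; eauto.
Qed.

(** The transitions without output, taken with no places, would form a one-way cut, and [p0] lies
    outside it. *)
Lemma transition_output t p0 : exists p, tp t p.
Proof.
case: (pickP (tp t)) => [p tpp|no]; first by exists p.
suff : @pred0 P p0 by [].
apply: (@cut_disconnects pred0 (fun u => [forall p, ~~ tp u p]) (inr t) (inl p0)) => //=.
  by move=> p u /forallP/(_ p)/negbTE ->.
by apply/forallP => p; rewrite no.
Qed.

Lemma transition_input t p0 : exists p, pt p t.
Proof.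
case: (pickP (pt^~ t)) => [p ptp|no]; first by exists p.
have [p tpp] := transition_output t p0.
have en : enabled h t by apply/enabledP => q; rewrite no.
have e : fire h t = h.
  apply: (bounded_no_growth bounded0 reachable_home); first exact/reach_step/en/reach_refl.
  by move=> q; rewrite fireE no; lia.
by have := fireE pt tp h t p; rewrite e no tpp; lia.
Qed.

Lemma place_output p (t0 : T) : exists t, pt p t.
Proof.
case: (pickP (pt p)) => [t ptt|no]; first by exists t.
suff : @pred0 T t0 by [].
apply: (@cut_disconnects (pred1 p) pred0 (inl p) (inr t0)) => //=.
by move=> q u /eqP->; rewrite no.
Qed.

(** * No reachable marking strictly above the home-cluster marking *)

Section HomeCluster.
Variable t0 : T.
Hypothesis fc : free_choice pt.
Hypothesis hE : forall p, h p = pt p t0.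

Lemma enabled_cluster m p t u : pt p t -> pt p u -> enabled m t -> enabled m u.
Proof.
move=> ptt ptu /enabledP en; apply/enabledP => q qu; apply: en.
exact: fc ptu _ _ qu ptt.
Qed.

Lemma enabled_home : enabled h t0.
Proof. by apply/enabledP => p; rewrite hE => ->. Qed.

Lemma not_dead m : reachable m0 m -> exists t, enabled m t.
Proof.
move=> rm; have [m' /reachableP[[|t s] /= fs <-] en] := live0 rm t0; first by exists t0.
by exists t; case/andP: fs.
Qed.

Lemma enabled_home_le m : enabled m t0 -> forall p, h p <= m p.
Proof. by move=> /enabledP en p; rewrite hE; case ptt: (pt p t0) => //; exact: en. Qed.

(* As long as a transition of [s] is enabled at the smaller marking, free choice lets
   it be moved to the front of [s] and fired at both markings. Once none is, the
   clusters enabled at [a] are untouched by [s], hence marked at [h]: then [a = h],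
   and [s] would have to delete the surplus tokens without using the home cluster,
   which is impossible since every transition has an output place. *)
Lemma dominating_run_home a b s : reachable h a -> (forall p, a p <= b p) ->
  fireable b s -> foldl fire b s = h -> a = b.
Proof.
have [n] := ubnP (size s); elim: n => // n IH in a b s *; rewrite ltnS => szs rha le_ab fs es.
(* Extensionality only serves to obtain a place [x], required by [transition_input] and
   [transition_output]. *)
apply/ffunP => x; suff -> : a = b by [].
have r0a : reachable m0 a by apply: reachable_trans reachable_home rha.
have [/has_splitP[s1 [t [s2 [es12 ent nos1]]]]|noa] := boolP (has (enabled a) s).
  have entb : enabled b t by apply: enabled_le ent => p _; apply: le_ab.
  rewrite es12 in fs es szs.
  have [u p us1 ptu|/andP[_ fs'] es'] := fireable_exchange fs entb.
    by apply: contra nos1 => ptt; apply/hasP; exists u => //; exact: (enabled_cluster ptt ptu ent).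
  have eab : fire a t = fire b t.
    apply: (IH _ _ (s1 ++ s2)) => //; last by rewrite -es -es'.
    - by move: szs; rewrite !size_cat /= addnS.
    - exact: reach_step.
    - by move=> p; rewrite !fireE; have := le_ab p; lia.
  apply/ffunP => p; have := fire_addE tp p ent; have := fire_addE tp p entb.
  by rewrite eab; lia.
have unconsumed p t : enabled a t -> pt p t -> ~~ has (pt p) s.
  move=> en ptt; apply: contra noa => /hasP[u us ptu].
  by apply/hasP; exists u => //; exact: (enabled_cluster ptt ptu en).
have en0 : enabled a t0.
  have [t ent] := not_dead r0a.
  have [p ptt] := transition_input t x.
  have := unconsumed_le fs (unconsumed p t ent ptt); rewrite es hE.
  have := le_ab p; have /enabledP/(_ p ptt) := ent.
  by case pt0: (pt p t0); [move=> *; exact: (enabled_cluster ptt pt0 ent) | lia].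
have ea : a = h.
  exact: (bounded_no_growth bounded0 reachable_home rha (enabled_home_le en0)).
case/lastP: s => [|s t] in szs fs es noa unconsumed *; first by rewrite ea -es.
(* [p] is marked at [h], hence in the home cluster; its original token was never consumed, so it
   would now hold two. *)
have [p tpp] := transition_output t x.
move: fs; rewrite -cats1 fireable_cat /= andbT => /andP[fs ent].
rewrite foldl_rcons in es; have := fire_addE tp p ent; rewrite es tpp hE.
case pt0: (pt p t0); last first.
  by have /enabledP/(_ p) := ent; case: (pt p t); lia.
have := unconsumed p t0 en0 pt0; rewrite has_rcons negb_or => /andP[/negbTE-> nos].
have := unconsumed_le fs nos; have := le_ab p; rewrite ea hE pt0; lia.
Qed.

Lemma above_home m : reachable m0 m -> (forall p, h p <= m p) -> m = h.
Proof.
move=> rm le_hm; have [s fs es] := (reachableP _ _ _ _).1 (home_h rm).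
by rewrite -(dominating_run_home (reach_refl _ _ _) le_hm fs es).
Qed.

(** * Allocations directed towards the home cluster *)

Definition covered s p := pt p t0 || has (pt p) s.

(* One transition per cluster, the home cluster excepted; later choices are consed on,
   and each choice sends a token to a cluster that was already treated. *)
Fixpoint allocation s : bool :=
  if s is t :: s' then
    [&& allocation s', [forall p, pt p t ==> ~~ covered s' p]
      & [exists p, tp t p && covered s' p]]
  else true.

Lemma allocation_consP t s :
  reflect [/\ allocation s, forall p, pt p t -> ~~ covered s p
            & exists2 p, tp t p & covered s p] (allocation (t :: s)).
Proof.
apply: (iffP and3P) => [[al /forallP dis /exists_inP[p tpp cp]]|[al dis [p tpp cp]]].
  by split=> //; [move=> q; apply/implyP/dis | exists p].
by split=> //; [apply/forallP => q; apply/implyP/dis | apply/exists_inP; exists p].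
Qed.

Lemma covered_cluster s p q t : pt p t -> pt q t -> covered s p -> covered s q.
Proof.
move=> ptt qtt /orP[pt0|/hasP[u us ptu]]; apply/orP; [left|right].
  exact: fc ptt _ _ qtt pt0.
by apply/hasP; exists u => //; exact: fc ptt _ _ qtt ptu.
Qed.

(** Otherwise the uncovered places and their consumers would form a one-way cut avoiding [t0]. *)
Lemma allocation_extend s p : allocation s -> ~~ covered s p ->
  exists2 t, allocation (t :: s) & exists2 q, pt q t & ~~ covered s q.
Proof.
move=> al ncp.
pose U t := [exists q, pt q t && ~~ covered s q].
case: (pickP (fun t => U t && [exists q, tp t q && covered s q])) => [t|no].
  case/andP=> /exists_inP[q qt ncq] /exists_inP[q' tq' cq'].
  exists t; last by exists q.
  apply/allocation_consP; split=> //; last by exists q'.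
  by move=> x xt; apply: contra ncq; apply: covered_cluster xt qt.
suff : U t0 by case/exists_inP => q qt0; rewrite /covered qt0.
apply: (@cut_disconnects (fun q => ~~ covered s q) U (inl p) (inr t0)) => //.
  by move=> q t ncq qt; apply/exists_inP; exists q.
move=> q t Ut tq; apply/negP => cq; have /negP := negbT (no t); apply.
by rewrite Ut; apply/exists_inP; exists q.
Qed.

Lemma allocation_complete s : allocation s ->
  exists s', allocation (s' ++ s) /\ forall p, covered (s' ++ s) p.
Proof.
have [n] := ubnP #|[pred p | ~~ covered s p]|; elim: n => // n IH in s *.
rewrite ltnS => szs al.
case: (pickP [pred p | ~~ covered s p]) => [p /= ncp|allc]; last first.
  by exists [::]; split=> // p; apply: negbFE (allc p).
have [t alt [q qt ncq]] := allocation_extend al ncp.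
have [|s' [al' cov']] := IH (t :: s) _ alt; last by exists (rcons s' t); rewrite cat_rcons.
apply: leq_trans szs; apply/proper_card/properP; split.
  by apply/subsetP => x; rewrite !inE /covered /= !negb_or => /and3P[-> _ ->].
by exists q; rewrite !inE // /covered /= qt orbT.
Qed.

Lemma allocation_cat_uncovered s s' u p :
  allocation (s' ++ s) -> u \in s' -> pt p u -> ~~ covered s p.
Proof.
elim: s' => //= t s' IH /allocation_consP[al dis _].
rewrite inE => /orP[/eqP-> ptt|us pu]; last exact: IH.
apply: contra (dis p ptt); rewrite /covered has_cat.
by case/orP=> ->; rewrite ?orbT.
Qed.

(* Geometric weights, growing towards the home cluster. *)
Lemma allocation_weight s : allocation s -> exists w : P -> nat,
  [/\ forall p, covered s p -> 0 < w p, forall p, ~~ covered s p -> w p = 0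
    & forall t, t \in s -> \sum_p pt p t * w p < \sum_p tp t p * w p].
Proof.
elim: s => [_|t s IH /allocation_consP[al dis [q tq cq]]].
  by exists (fun p => pt p t0); split=> // p; rewrite /covered orbF; case: (pt p t0).
have [w [wpos w0 wlt]] := IH al.
(* The preset of [t] had weight 0 and now weighs at most [#|P|], while its covered output [q] weighs
   at least [#|P|.+1]. *)
exists (fun p => pt p t + #|P|.+1 * w p); split=> [p|p|u].
- rewrite /covered /= orbCA => /orP[->//|cp]; have := wpos p cp; lia.
- by rewrite /covered /= orbCA negb_or => /andP[/negbTE-> ncp]; rewrite w0 // muln0.
rewrite inE => /orP[/eqP->|us].
  have le1 : \sum_p pt p t * (pt p t + #|P|.+1 * w p) <= #|P|.
    rewrite -sum1_card; apply: leq_sum => p _; case ptt: (pt p t) => //.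
    by rewrite (w0 _ (dis _ ptt)) muln0.
  apply: leq_ltn_trans le1 _; rewrite (bigD1 q) //= tq mul1n.
  by have := wpos q cq; nia.
have -> : \sum_p pt p u * (pt p t + #|P|.+1 * w p) = #|P|.+1 * \sum_p pt p u * w p.
  rewrite big_distrr; apply: eq_bigr => p _ /=; case pu: (pt p u); last by rewrite muln0.
  case ptt: (pt p t); last by rewrite !mul1n.
  have /negP[] := dis p ptt; apply/orP; right; by apply/hasP; exists u.
have le2 : #|P|.+1 * \sum_p tp u p * w p <= \sum_p tp u p * (pt p t + #|P|.+1 * w p).
  by rewrite big_distrr; apply: leq_sum => p _ /=; nia.
by apply: leq_trans le2; rewrite ltn_pmul2l // wlt.
Qed.

(* Allocated firings increase the weight, which is bounded, so they come to a halt. *)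
Lemma allocation_run s m : allocation s -> (forall p, covered s p) -> reachable m0 m ->
  exists s', [/\ fireable m s', {subset s' <= s} & enabled (foldl fire m s') t0].
Proof.
move=> al cov; have [w [_ _ wlt]] := allocation_weight al.
have [K bK] := bounded0; pose W m := \sum_p m p * w p.
have [n] := ubnP (\sum_p K * w p - W m); elim: n => // n IH in m *.
rewrite ltnS => leW rm.
have [en0|nen0] := boolP (enabled m t0); first by exists [::].
have [x xt0 _] : exists2 x, pt x t0 & ~~ (0 < m x).
  by move: nen0; rewrite negb_forall => /existsP[x]; rewrite negb_imply => /andP[]; exists x.
have [u us enu] : exists2 u, u \in s & enabled m u.
  have [t ent] := not_dead rm; have [p ptt] := transition_input t x.
  case/orP: (cov p) => [pt0|/hasP[u us pu]].
    by rewrite (enabled_cluster ptt pt0 ent) in nen0.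
  by exists u => //; exact: (enabled_cluster ptt pu ent).
have rmu : reachable m0 (fire m u) by apply: reach_step.
have eW : W (fire m u) + \sum_p pt p u * w p = W m + \sum_p tp u p * w p.
  by rewrite -!big_split; apply: eq_bigr => p _ /=; rewrite -!mulnDl fire_addE.
have leK : W (fire m u) <= \sum_p K * w p.
  by apply: leq_sum => p _; apply: leq_mul => //; apply: bK.
have [||s' [fs sub en0]] := IH (fire m u) => //; first by have := wlt u us; lia.
exists (u :: s'); split=> //=; first by rewrite enu.
by move=> v; rewrite inE => /orP[/eqP->//|/sub].
Qed.

(** * Rooted paths and the tokens on them *)

(** The [has] condition keeps the cluster of [t] from being met again, so that the choices along the
    path form an allocation. *)
Inductive rooted_path : seq P -> Prop :=
| rooted_home p : pt p t0 -> rooted_path [:: p]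
| rooted_step p t p' r : pt p t -> ~~ has (pt^~ t) (p' :: r) -> tp t p' ->
    rooted_path (p' :: r) -> rooted_path [:: p, p' & r].

(** The sum is the load of the path at [h]: only the last place lies in the home cluster. *)
Lemma rooted_path_home r : rooted_path r ->
  has (pt^~ t0) r /\ \sum_(q <- r) (pt q t0 : nat) = 1.
Proof.
elim=> [p pt0|p t p' r' ptt nor _ _ [hasr sumr]]; first by rewrite /= pt0 big_seq1 pt0.
split; first by apply/orP; right.
rewrite big_cons sumr.
case pt0: (pt p t0) => //; case/negP: nor.
by apply: sub_has hasr => q qt0; exact: fc pt0 _ _ qt0 ptt.
Qed.

(** The allocation consists of the choices along the path; each takes one token from the path and
    returns one to its next place. *)
Lemma rooted_path_allocation r : rooted_path r -> exists s,
  [/\ allocation s, forall p, p \in r -> covered s p,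
      forall u, u \in s -> has (pt^~ u) r
    & forall u, u \in s -> \sum_(q <- r) (pt q u : nat) <= \sum_(q <- r) (tp u q : nat)].
Proof.
elim=> [p pt0|p t p' r' ptt nor tp' rr [s [al cov hass les]]].
  by exists [::]; split=> // q; rewrite inE => /eqP->; rewrite /covered pt0.
have ncov q : pt q t -> ~~ covered s q.
  move=> qt; apply/negP => /orP[qt0|/hasP[u us qu]]; case/negP: nor.
    have [hasr _] := rooted_path_home rr.
    by apply: sub_has hasr => x xt0; exact: fc qt0 _ _ xt0 qt.
  by apply: sub_has (hass u us) => x xu; exact: fc qu _ _ xu qt.
exists (t :: s); split.
- by apply/allocation_consP; split=> //; exists p' => //; apply: cov; rewrite mem_head.
- move=> q; rewrite inE /covered /= orbCA => /orP[/eqP->|qr]; first by rewrite ptt.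
  by apply/orP; right; apply: cov.
- move=> u; rewrite inE => /orP[/eqP->|us]; first by rewrite /= ptt.
  by apply/orP; right; apply: hass.
move=> u; rewrite inE => /orP[/eqP->|us]; rewrite !(big_cons _ _ p).
  rewrite ptt big_seq big1 => [|q qr]; last by rewrite (negbTE (hasPn nor q qr)).
  by rewrite big_cons tp'; lia.
suff -> : pt p u = false by have := les u us; lia.
by apply: contraNF (ncov p ptt) => pu; apply/orP; right; apply/hasP; exists u.
Qed.

(** Completing the allocation adds only transitions that take nothing from the path, so its load
    never drops on the way to [h], where it is 1. *)
Lemma rooted_path_load r m : rooted_path r -> reachable m0 m -> \sum_(q <- r) m q <= 1.
Proof.
move=> rr rm; have [s [al cov hass les]] := rooted_path_allocation rr.
have [s' [al' cov']] := allocation_complete al.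
have les' u : u \in s' ++ s ->
    \sum_(q <- r) (pt q u : nat) <= \sum_(q <- r) (tp u q : nat).
  rewrite mem_cat => /orP[|/les//].
  move=> us'; rewrite big_seq big1 // => q qr.
  by case qu: (pt q u) => //; have := allocation_cat_uncovered al' us' qu; rewrite cov.
have [sg [fs sub en0]] := allocation_run al' cov' rm.
have load_le : \sum_(q <- r) m q <= \sum_(q <- r) foldl fire m sg q.
  elim: sg m fs sub {rm en0} => //= u sg IH m /andP[enu fs] sub.
  apply: leq_trans (IH _ fs _); last by move=> v vs; apply: sub; rewrite inE vs orbT.
  have : \sum_(q <- r) fire m u q + \sum_(q <- r) (pt q u : nat)
      = \sum_(q <- r) m q + \sum_(q <- r) (tp u q : nat).
    by rewrite -!big_split; apply: eq_bigr => q _ /=; rewrite fire_addE.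
  by have := les' u (sub u (mem_head u sg)); lia.
apply: leq_trans load_le _.
rewrite (above_home _ (enabled_home_le en0)); last first.
  exact: reachable_trans rm (reachable_run fs).
by under eq_bigr do rewrite hE; rewrite (rooted_path_home rr).2.
Qed.

Lemma rooted_path_exists p : exists r, rooted_path (p :: r).
Proof.
have [s' [al cov]] := @allocation_complete [::] isT; move: (s' ++ [::]) al (cov p) => s al.
(* Staying among the places covered by [s] keeps the path off the preset of each later choice. *)
suff ex q : covered s q ->
    exists2 r, rooted_path (q :: r) & forall x, x \in q :: r -> covered s x.
  by move=> /ex[r rr _]; exists r.
elim: s al q {s' cov p} => [_|t s IH /allocation_consP[al dis [p' tp' cp']]] q.
  rewrite /covered orbF => qt0; exists [::]; first exact: rooted_home.
  by move=> x; rewrite inE => /eqP->; rewrite qt0.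
have covW x : covered s x -> covered (t :: s) x.
  by case/orP=> cx; rewrite /covered /= cx ?orbT.
have [cq _|ncq] := boolP (covered s q).
  by have [r rr cr] := IH al _ cq; exists r => // x /cr/covW.
rewrite /covered /= orbCA => /orP[qt|cq]; last by rewrite /covered cq in ncq.
have [r rr cr] := IH al _ cp'.
exists (p' :: r).
  by apply: rooted_step qt _ tp' rr; apply/hasPn => x /cr; apply: contraL; apply: dis.
by move=> x; rewrite inE => /orP[/eqP->|/cr/covW//]; rewrite qt orbT.
Qed.

Lemma rooted_path_inv p p' r : rooted_path [:: p, p' & r] ->
  exists t, [/\ pt p t, ~~ has (pt^~ t) (p' :: r), tp t p' & rooted_path (p' :: r)].
Proof. by move=> rr; inversion rr as [|? t]; subst; exists t. Qed.

Lemma rooted_path_cluster p q t r : pt p t -> pt q t ->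
  rooted_path (p :: r) -> rooted_path (q :: r).
Proof.
move=> ptt qt; have qp u : pt p u -> pt q u by apply: fc ptt _ _ qt.
case: r => [|p' r] rr; first by inversion rr; apply/rooted_home/qp.
by have [u [pu nou up' rr']] := rooted_path_inv rr; apply: rooted_step (qp u pu) nou up' rr'.
Qed.

(** Cut a run to [h] at its first transition consuming from the path: with load at most 1, the token
    taken is the one on [p]. If there is none, [p] is still marked at [h]. *)
Lemma rooted_path_enable p r m : rooted_path (p :: r) -> reachable m0 m -> 0 < m p ->
  exists s, [/\ fireable m s, forall u, u \in s -> ~~ has (pt^~ u) (p :: r)
    & exists2 t, pt p t & enabled (foldl fire m s) t].
Proof.
move=> rr rm mp; have [s fs es] := (reachableP _ _ _ _).1 (home_h rm).
have keep s1 : fireable m s1 -> (forall u, u \in s1 -> ~~ has (pt^~ u) (p :: r)) ->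
    0 < foldl fire m s1 p.
  move=> f1 avoid; apply: leq_trans mp (unconsumed_le f1 _).
  by apply/hasPn => u /avoid; rewrite /= negb_or => /andP[].
have [/has_splitP[s1 [u [s2 [e12 hasu no1]]]]|nos] :=
    boolP (has (fun u => has (pt^~ u) (p :: r)) s); last first.
  have avoid u : u \in s -> ~~ has (pt^~ u) (p :: r) by apply: (hasPn nos).
  exists s; split=> //; exists t0; last by rewrite es enabled_home.
  by have := keep s fs avoid; rewrite es hE; case: (pt p t0).
have avoid v : v \in s1 -> ~~ has (pt^~ v) (p :: r) by apply: (hasPn no1).
move: fs; rewrite e12 fireable_cat => /andP[f1 /= /andP[enu _]].
exists s1; split=> //; exists u => //.
case/hasP: hasu => q; rewrite inE => /orP[/eqP-> //|qr qu].
have := rooted_path_load rr (reachable_trans rm (reachable_run f1)).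
rewrite big_cons (big_rem q) //=.
by have := keep _ f1 avoid; have /enabledP/(_ q qu) := enu; lia.
Qed.

(** Once the cluster of the marked place is enabled, free choice allows firing the transition that
    leads to the next place. *)
Lemma rooted_path_push pre p r m : rooted_path (pre ++ p :: r) -> reachable m0 m ->
  0 < m (head p pre) ->
  exists s, [/\ fireable m s, forall u, u \in s -> ~~ has (pt^~ u) (p :: r)
    & exists2 t, pt p t & enabled (foldl fire m s) t].
Proof.
elim: pre m => [|x pre IH] m /=; first exact: rooted_path_enable.
move=> rr rm mx; have [s [fs avoid [t xt ent]]] := rooted_path_enable rr rm mx.
have [u [xu nou xu' rr']] : exists u, [/\ pt x u, ~~ has (pt^~ u) (pre ++ p :: r),
    tp u (head p pre) & rooted_path (pre ++ p :: r)].
  by case: (pre) rr => [|y pre'] rr; apply: rooted_path_inv rr.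
have enu := enabled_cluster xt xu ent.
have fsu : fireable m (rcons s u) by rewrite -cats1 fireable_cat fs /= enu.
have [||s' [fs' avoid' en']] := IH (foldl fire m (rcons s u)) rr'.
- exact: reachable_trans rm (reachable_run fsu).
- by rewrite foldl_rcons fireE xu'; lia.
exists (rcons s u ++ s'); split; [by rewrite fireable_cat fsu| |by rewrite foldl_cat].
move=> v; rewrite mem_cat mem_rcons inE -orbA => /or3P[/eqP->|vs|/avoid'//].
  by move: nou; rewrite has_cat negb_or => /andP[].
by have := avoid v vs; rewrite [has _ (x :: _)]/= has_cat !negb_or => /and3P[].
Qed.

(* Traces the token that reaches [p] back in time, always through a place unmarked at
   [m]; the clusters met this way have strictly earlier first firings, so they differ. *)
Lemma rooted_path_trace p r m s : rooted_path (p :: r) -> fireable m s ->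
  (forall u, u \in s -> ~~ has (pt^~ u) r) -> m p = 0 -> 0 < foldl fire m s p ->
  exists x pre, rooted_path (x :: pre ++ p :: r) /\ exists2 t, pt x t & enabled m t.
Proof.
have [n] := ubnP (size s); elim: n => // n IH in p r s *; rewrite ltnS => szs rr fs avoid mp sp.
have [s1 [t [s2 [e12 e1 no1 npt tpp]]]] := first_mark fs mp sp.
rewrite e12 in fs avoid szs; move: fs; rewrite fireable_cat /= => /and3P[f1 ent _].
have rr' x : pt x t -> rooted_path [:: x, p & r].
  move=> xt; apply: rooted_step xt _ tpp rr; rewrite /= negb_or npt.
  by apply: avoid; rewrite mem_cat mem_head orbT.
have [enm|nenm] := boolP (enabled m t).
  have [x xt] := transition_input t p.
  by exists x, [::]; split; [apply: rr' | exists t].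
have [x xt mx] : exists2 x, pt x t & m x = 0.
  move: nenm; rewrite negb_forall => /existsP[x]; rewrite negb_imply => /andP[xt].
  by exists x => //; lia.
have [|u us1||y [pre [rry eny]]] := IH x (p :: r) s1 _ (rr' x xt) f1 _ mx.
- by move: szs; rewrite size_cat /=; lia.
- rewrite /= negb_or (hasPn no1) //; apply: avoid.
  by rewrite mem_cat us1.
- by have /enabledP/(_ x xt) := ent.
by exists y, (rcons pre x); rewrite cat_rcons.
Qed.

Lemma home_cluster_lucent_le m1 m2 : reachable m0 m1 -> reachable m0 m2 ->
  en pt m1 = en pt m2 -> forall p, m1 p <= m2 p.
Proof.
move=> r1 r2 /setP en12 p; rewrite leqNgt; apply/negP => lt21.
have {}en12 t : enabled m1 t = enabled m2 t by have := en12 t; rewrite !inE.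
have marked m x t : pt x t -> enabled m t -> 0 < m x by move=> xt /enabledP; apply.
have [r rr] := rooted_path_exists p.
(* The load bound gives [m1 p <= 1], which determines both values. *)
have [m1p m2p] : 0 < m1 p /\ m2 p = 0.
  by have := rooted_path_load rr r1; rewrite big_cons; lia.
have [s [fs avoid [t ptt ent]]] := rooted_path_enable rr r1 m1p.
have [q qt m1q] : exists2 q, pt q t & m1 q = 0.
  have : ~~ enabled m1 t.
    by rewrite en12; apply/negP => /(marked _ _ _ ptt); rewrite m2p.
  rewrite negb_forall => /existsP[x]; rewrite negb_imply => /andP[xt].
  by exists x => //; lia.
have rrq : rooted_path (q :: r) := rooted_path_cluster ptt qt rr.
have [x [pre [rrx [tx xtx enx]]]] : exists x pre, rooted_path (x :: pre ++ q :: r) /\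
    exists2 t, pt x t & enabled m1 t.
  apply: (rooted_path_trace rrq fs) => //; last exact: marked qt ent.
  by move=> u /avoid; rewrite /= negb_or => /andP[].
have m2x : 0 < m2 x by apply: (marked _ _ _ xtx); rewrite -en12.
have [s' [fs' avoid' [t' qt' ent']]] := @rooted_path_push (x :: pre) q r m2 rrx r2 m2x.
have pt' : pt p t' by exact: fc qt _ _ ptt qt'.
have [y [pre' [rry [ty yty eny]]]] : exists y pre, rooted_path (y :: pre ++ p :: r) /\
    exists2 t, pt y t & enabled m2 t.
  apply: (rooted_path_trace rr fs') => //; last exact: marked pt' ent'.
  by move=> u /avoid'; rewrite /= negb_or => /andP[].
have m1y : 0 < m1 y by apply: (marked _ _ _ yty); rewrite en12.
have := rooted_path_load rry r1; rewrite big_cons big_cat big_cons /=.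
by move: m1y m1p; clear; lia.
Qed.

End HomeCluster.
End HomeMarking.

(** * Clusters as presets, and lucency *)

(** By free choice, the preset of [t] together with all transitions of equal preset is closed under
    [cluster_step]. *)
Lemma cluster_placeE (P T : finType) (pt : P -> T -> bool) p t x :
  free_choice pt -> x = inr t \/ (exists2 q, x = inl q & pt q t) ->
  (inl p \in cluster pt x) = pt p t.
Proof.
move=> fc xt; rewrite inE; apply/idP/idP.
  pose C (y : P + T) := match y with inl q => pt q t | inr u => [forall q, pt q u == pt q t] end.
  have Cx : C x by case: xt => [->|[q -> //]]; apply/forallP => q.
  have Cstep y z : cluster_step pt y z -> C y -> C z.
    case: y z => [q|u] [q'|u'] //= qu.
      move=> qt; apply/forallP => v; apply/eqP; apply/idP/idP => vu.
        exact: fc qu _ _ vu qt.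
      exact: fc qt _ _ vu qu.
    by move/forallP/(_ q')/eqP <-.
  case/connectP=> w xw e; change (C (inl p)); rewrite e.
  by elim: w x xw Cx {e xt} => //= z w IH x /andP[xz zw] /(Cstep _ _ xz) /IH; apply.
move=> ptt; case: xt => [->|[q -> qt]]; first exact: connect1.
by apply: connect_trans (connect1 (_ : cluster_step pt (inl q) (inr t)) ) (connect1 _).
Qed.

Theorem theorem8p1 (P T : finType) (pt : P -> T -> bool) (tp : T -> P -> bool)
  (m0 : marking P) :
  weakly_connected pt tp -> free_choice pt ->
  perpetual pt tp m0 -> lucent pt tp m0.
Proof.
move=> conn fc [live0 bounded0 [x home]] m1 m2 r1 r2 en12.
case: (pickP (@predT T)) => [t1 _|noT]; last first.
  have stuck m : reachable pt tp m0 m -> m = m0 by case=> // m' t; have := noT t.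
  by rewrite (stuck m1 r1) (stuck m2 r2).
have [t0 xt0] : exists t0, x = inr t0 \/ exists2 q, x = inl q & pt q t0.
  case: x home => [q|t] home; last by exists t; left.
  have [t qt] := place_output conn live0 bounded0 home q t1.
  by exists t; right; exists q.
have hE p : cluster_marking pt x p = pt p t0.
  by rewrite ffunE (cluster_placeE p fc xt0); case: (pt p t0).
have le := home_cluster_lucent_le conn live0 bounded0 home fc hE.
by apply/ffunP => p; apply/eqP; rewrite eqn_leq !le.
Qed.
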